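(* Let $\mathfrak{H}$ be a separable complex Hilbert space and let $S$ be a densely defined closed symmetric operator in $\mathfrak{H}$ which is semibounded from below with lower bound $\kappa\ge 0$, that is, $(Sf,f)_{\mathfrak{H}}\ge \kappa (f,f)_{\mathfrak{H}}$ for all $f\in\operatorname{dom}(S)$. Let $A$ be a nonnegative self-adjoint extension of $S$ in $\mathfrak{H}$ such that $\ker(A)\neq\{0\}$, and let $V\ge 0$ be a self-adjoint operator in $\mathfrak{H}$ which is relatively compact with respect to $A$, that is, $\operatorname{dom}(A)\subseteq\operatorname{dom}(V)$ and $V(A+I_{\mathfrak{H}})^{-1}$ is a compact operator in $\mathfrak{H}$. Assume, in addition, that $\ker(A)\not\subseteq\ker(V)$. Then $$\sigma(A+\alpha V)\cap(-\infty,0)\neq\emptyset\quad\text{for any }\alpha<0.$$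
   Context: All operators are linear and possibly unbounded. $\operatorname{dom}(T)$, $\ker(T)$ and $\sigma(T)$ denote the domain, kernel and spectrum of an operator $T$, and $I_{\mathfrak{H}}$ is the identity operator on $\mathfrak{H}$. For $\alpha\in\mathbb{R}$, the operator $A+\alpha V$ is defined on $\operatorname{dom}(A+\alpha V)=\operatorname{dom}(A)$; by the relative compactness of $V$ it is self-adjoint in $\mathfrak{H}$. *)

(* Defs.v *)
From HB Require Import structures.
From mathcomp Require Import all_boot all_order all_algebra.
From mathcomp Require Export complex.
From mathcomp Require Import all_classical all_reals all_analysis.

Set Implicit Arguments.
Unset Strict Implicit.
Unset Printing Implicit Defensive.

Import Order.TTheory GRing.Theory Num.Theory.
Import numFieldNormedType.Exports.

Local Open Scope classical_set_scope.
Local Open Scope complex_scope.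
Local Open Scope ring_scope.

(* The inner product is linear in its first argument and antilinear in its
   second one; completeness refers to the norm it induces. *)
HB.mixin Record CompleteNormedModule_isHilbert (R : realType) (H : Type)
    of CompleteNormedModule R[i] H := {
  inner : {dot H for (@Num.conj R[i])} ;
  inner_normE : forall f : H, `|f| ^+ 2 = inner f f
}.

#[short(type="hilbertType")]
HB.structure Definition Hilbert (R : realType) :=
  {H of CompleteNormedModule R[i] H & CompleteNormedModule_isHilbert R H}.

Notation "''(' f , g )" := (inner f g) (format "''(' f ,  g )") : ring_scope.

Definition separable_space (T : topologicalType) : Prop :=
  exists2 D : set T, countable D & dense D.

Section operators.
Context {R : realType} {H : hilbertType R}.
Local Notation C := R[i].

(* A possibly unbounded operator in H: the values of [app] outside [dom] carry
   no meaning. Linearity is the separate predicate [linear_operator]. *)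
Record operator := Operator { dom : set H ; app :> H -> H }.

Implicit Types (S T : operator) (a z : C).

Definition linear_operator T : Prop :=
  dom T 0 /\
  forall a f g, dom T f -> dom T g ->
    dom T (a *: f + g) /\ T (a *: f + g) = a *: T f + T g.

Definition op_ker T : set H := [set f | dom T f /\ T f = 0].

Definition op_range T : set H := T @` dom T.

Definition op_graph T : set (H * H) := [set p | dom T p.1 /\ p.2 = T p.1].

Definition op_extends S T : Prop :=
  dom S `<=` dom T /\ forall f, dom S f -> T f = S f.

Definition op_eq S T : Prop := op_extends S T /\ op_extends T S.

Definition op_id : operator := Operator setT id.

Definition op_add S T : operator :=
  Operator (dom S `&` dom T) (fun f => S f + T f).

Definition op_scale a T : operator := Operator (dom T) (fun f => a *: T f).

Definition op_comp S T : operator :=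
  Operator [set f | dom T f /\ dom S (T f)] (fun f => S (T f)).

Definition op_injective T : Prop := {in dom T &, injective T}.

(* Meaningful when [op_injective T]. *)
Definition op_inv T : operator :=
  Operator (op_range T) (fun g => xget 0 [set f | dom T f /\ T f = g]).

Definition densely_defined T : Prop := dense (dom T).

Definition closed_operator T : Prop := closed (op_graph T).

Definition symmetric_operator T : Prop :=
  forall f g, dom T f -> dom T g -> '(T f, g) = '(f, T g).

(* Meaningful when [T] is densely defined, so that [h] is unique. *)
Definition op_adj T : operator :=
  let is_adj g h := forall f, dom T f -> '(T f, g) = '(f, h) in
  Operator [set g | exists h, is_adj g h] (fun g => xget 0 (is_adj g)).

Definition self_adjoint T : Prop := densely_defined T /\ op_eq T (op_adj T).

Definition bounded_below T (kappa : R) : Prop :=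
  forall f, dom T f -> kappa%:C * '(f, f) <= '(T f, f).

Definition nonnegative T : Prop := bounded_below T 0.

Definition bounded_operator T : Prop :=
  [/\ dom T = setT, linear_operator T & continuous T].

Definition compact_operator T : Prop :=
  [/\ dom T = setT, linear_operator T &
      forall B : set H, bounded_set B -> precompact (T @` B)].

Definition resolvent_set T : set C :=
  [set z | let Tz := op_add T (op_scale (- z) op_id) in
           op_injective Tz /\ bounded_operator (op_inv Tz)].

Definition spectrum T : set C := ~` resolvent_set T.

Definition relatively_compact V A : Prop :=
  dom A `<=` dom V /\ compact_operator (op_comp V (op_inv (op_add A op_id))).

End operators.
Arguments operator {R} H.

(* Main.v *)
Require Import Defs.
From mathcomp Require Import all_boot all_order all_algebra.
From mathcomp Require Import ring lra.
From mathcomp Require Import all_classical all_reals all_analysis.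

Import Order.TTheory GRing.Theory Num.Theory.
Import numFieldNormedType.Exports.

Local Open Scope classical_set_scope.
Local Open Scope complex_scope.
Local Open Scope ring_scope.

(* Put T = A + alpha V and suppose that every -s with s > 0 is in the resolvent
   set of T. Only the symmetry of T is needed to get (T f, f) >= 0 on dom T.
   Let q be the largest constant with |(T + t) u|^2 >= q |u|^2 on dom T, i.e.
   q^-1/2 is the norm of (T + t)^-1, and let b = sqrt q. If b < t, then T + t - b
   and T + t + b are bounded below, hence so is their product (T + t)^2 - q, and
   this lets q be increased. So |(T + t) f| >= t |f| for all t > 0; expanding the
   square, dividing by t and letting t tend to infinity gives (T f, f) >= 0.
   On the other hand, a vector f of ker A outside ker V has (V f, f) > 0 by the
   Cauchy-Schwarz inequality for the form of V, so (T f, f) = alpha (V f, f) < 0. *)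

Definition re_inner {R : realType} {H : hilbertType R} (f g : H) : R :=
  complex.Re '(f, g).

(* The norm of [H] takes its (real) values in [R[i]]. *)
Definition re_norm {R : realType} {H : hilbertType R} (f : H) : R :=
  complex.Re `|f|.

(** * Real part of the inner product, and the norm with values in [R] *)

Section re_inner.
Context {R : realType} {H : hilbertType R}.
Implicit Types (f g h : H) (a : R).

Lemma re_innerDl f g h : re_inner (f + g) h = re_inner f h + re_inner g h.
Proof. by rewrite /re_inner linearDl raddfD. Qed.

Lemma re_innerC f g : re_inner f g = re_inner g f.
Proof.
have ReJ (z : R[i]) : complex.Re (Num.conj z) = complex.Re z by case: z.
by rewrite /re_inner (hermC inner) expr0 mul1r; exact: ReJ.
Qed.

Lemma re_innerZl a f g : re_inner (a%:C *: f) g = a * re_inner f g.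
Proof.
have ReM (z : R[i]) : complex.Re (a%:C * z) = a * complex.Re z.
  by case: z => x y /=; rewrite mul0r subr0.
by rewrite /re_inner linearZl_LR; exact: ReM.
Qed.

Lemma re_innerDr f g h : re_inner h (f + g) = re_inner h f + re_inner h g.
Proof. by rewrite -!(re_innerC _ h) re_innerDl. Qed.

Lemma re_innerZr a f g : re_inner g (a%:C *: f) = a * re_inner g f.
Proof. by rewrite -!(re_innerC _ g) re_innerZl. Qed.

Lemma re_inner_sqrDZ a f g :
  re_inner (f + a%:C *: g) (f + a%:C *: g) =
  re_inner f f + 2 * a * re_inner f g + a ^+ 2 * re_inner g g.
Proof.
rewrite !(re_innerDl, re_innerDr) !(re_innerZl, re_innerZr) (re_innerC g f).
ring.
Qed.

Lemma norm_re_norm f : `|f| = (re_norm f)%:C.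
Proof. by rewrite /re_norm RRe_real // normr_real. Qed.

Lemma re_norm_ge0 f : 0 <= re_norm f.
Proof. by have := normr_ge0 f; rewrite norm_re_norm lecR. Qed.

Lemma re_innerE f : re_inner f f = re_norm f ^+ 2.
Proof. by rewrite /re_inner -inner_normE norm_re_norm -rmorphXn. Qed.

Lemma re_inner_ge0 f : 0 <= re_inner f f.
Proof. by rewrite re_innerE sqr_ge0. Qed.

Lemma re_normD f g : re_norm (f + g) <= re_norm f + re_norm g.
Proof.
by have := ler_normD f g; rewrite !norm_re_norm -(rmorphD (real_complex R)) lecR.
Qed.

Lemma re_normZ a f : re_norm (a%:C *: f) = `|a| * re_norm f.
Proof.
apply: (@pexpIrn _ 2); rewrite ?nnegrE ?mulr_ge0 ?re_norm_ge0 //.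
rewrite -re_innerE re_innerZl re_innerZr re_innerE exprMn real_normK ?num_real //.
by rewrite mulrA -expr2.
Qed.

Lemma re_norm_gt0 f : f != 0 -> 0 < re_norm f.
Proof. by rewrite -normr_gt0 norm_re_norm (ltcR 0). Qed.

End re_inner.

(** * Resolvent estimates and positivity of quadratic forms *)

Section operators.
Context {R : realType} {H : hilbertType R}.
Implicit Types (T : operator H) (f g : H) (s t : R).

Lemma linear_opD T f g : linear_operator T -> dom T f -> dom T g ->
  dom T (f + g) /\ T (f + g) = T f + T g.
Proof. by move=> [_ linT] df dg; have := linT 1 f g df dg; rewrite !scale1r. Qed.

Lemma linear_op0 T : linear_operator T -> T 0 = 0.
Proof.
move=> linT; have [d0 _] := linT.
have [_ /eqP] := linear_opD _ _ _ linT d0 d0.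
by rewrite addr0 -subr_eq0 opprD addNKr oppr_eq0 => /eqP.
Qed.

Lemma linear_opZ T (a : R[i]) f : linear_operator T -> dom T f ->
  dom T (a *: f) /\ T (a *: f) = a *: T f.
Proof.
move=> linT df; have [d0 /(_ a f 0 df d0)] := linT.
by rewrite linear_op0 // !addr0.
Qed.

Lemma continuous_op_bounded T :
  bounded_operator T ->
  exists2 M : R, 0 < M & forall g, re_norm (T g) <= M * re_norm g.
Proof.
move=> [domT linT contT].
have T0 := linear_op0 T linT.
have /cvgrPdist_lt/(_ 1 ltr01) := contT 0.
rewrite T0 => /nbhs_normP[e /= e0 He].
(* The radius lives in [R[i]]; being positive, it is real. *)
have [d ed] : exists d : R, e = d%:C.
  by exists (complex.Re e); rewrite RRe_real // gtr0_real.
move: e0 He; rewrite ed (ltcR 0) => d0 He.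
exists (2 / d); first by rewrite divr_gt0.
move=> g; have [->|g0] := eqVneq g 0.
  rewrite T0 -[0 in leLHS](scale0r 0) (re_normZ 0) normr0 mul0r.
  by rewrite mulr_ge0 ?re_norm_ge0 // divr_ge0 // ltW.
have ng := re_norm_gt0 g g0.
(* Rescales [g] to norm [d / 2], inside the ball that [T] maps into the unit ball. *)
pose a := d / 2 / re_norm g.
have a0 : 0 < a by rewrite !divr_gt0.
have [|_ Tag] := linear_opZ T a%:C g linT; first by rewrite domT.
have := He (a%:C *: g).
rewrite /ball_ /= !sub0r !normrN !norm_re_norm ltcR Tag !re_normZ gtr0_norm //.
rewrite -[1]/(1%:C) ltcR.
have ag : a * re_norm g = d / 2 by rewrite divfK ?gt_eqF.
rewrite ag => /(_ ltac:(lra)) lt1.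
have aM : a * (2 / d * re_norm g) = 1 by rewrite /a; field; rewrite !gt_eqF.
by rewrite -(ler_pM2l a0) aM ltW.
Qed.

(** If [M] bounds the inverse of [T + s], then [M^-1] serves as [m]. *)
Lemma resolvent_coercive T s : resolvent_set T (- s)%:C ->
  exists2 m : R, 0 < m &
    forall f, dom T f -> m * re_norm f <= re_norm (T f + s%:C *: f).
Proof.
rewrite /resolvent_set /= => -[injT bndT].
have [M M0 HM] := continuous_op_bounded _ bndT.
exists M^-1; first by rewrite invr_gt0.
move=> f domf; rewrite mulrC ler_pdivrMr // mulrC.
set g := T f + _.
suff <- : op_inv (op_add T (op_scale (- (- s)%:C) op_id)) g = f by exact: HM.
(* [xget] picks some preimage of [g], as [f] is one; injectivity identifies it with [f]. *)
rewrite /=; case: xgetP => [h _ [domh eqh]|/(_ f)]; last first.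
  by case; split => //=; rewrite rmorphN opprK.
apply: injT; rewrite ?inE //=.
by rewrite eqh /g rmorphN opprK.
Qed.

Lemma resolvent_surjective T s g : resolvent_set T (- s)%:C ->
  exists2 f, dom T f & T f + s%:C *: f = g.
Proof.
move=> -[_ [/= domT _ _]].
have [f [domf _] <-] : op_range (op_add T (op_scale (- (- s)%:C) op_id)) g.
  by rewrite domT.
by exists f => //=; rewrite rmorphN opprK.
Qed.

Lemma symmetric_norm_lower_bound T t f :
  linear_operator T -> symmetric_operator T ->
  (forall s, 0 < s -> resolvent_set T (- s)%:C) ->
  0 < t -> dom T f ->
  t ^+ 2 * re_inner f f <= re_inner (T f + t%:C *: f) (T f + t%:C *: f).
Proof.
move=> linT symT res t0 domf; rewrite leNgt; apply/negP => lt_f.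
pose E := [set c : R | forall h, dom T h ->
   c * re_inner h h <= re_inner (T h + t%:C *: h) (T h + t%:C *: h)].
have f_gt0 : 0 < re_inner f f.
  rewrite lt0r re_inner_ge0 andbT; apply: contraTneq lt_f => ->.
  by rewrite mulr0 -leNgt re_inner_ge0.
(* The quotient at the offending [f] bounds [E] and lies below [t ^+ 2]. *)
pose c0 := re_inner (T f + t%:C *: f) (T f + t%:C *: f) / re_inner f f.
have ubE : ubound E c0.
  by move=> c /(_ f domf); rewrite ler_pdivlMr.
have [m m0 Hm] := resolvent_coercive _ _ (res t t0).
have Em : E (m ^+ 2).
  move=> h domh; rewrite !re_innerE -exprMn ler_sqr ?nnegrE ?re_norm_ge0 ?Hm //.
  by rewrite mulr_ge0 ?re_norm_ge0 ?ltW.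
have supE : has_sup E by split; [exists (m ^+ 2)|exists c0].
pose q := sup E.
have q_ub : ubound E q by exact: sup_upper_bound.
have q0 : 0 < q by apply: lt_le_trans (q_ub _ Em); rewrite exprn_gt0.
have qt : q < t ^+ 2.
  apply: le_lt_trans (ge_sup _ ubE) _; first by exists (m ^+ 2).
  by rewrite ltr_pdivrMr.
(* The supremum is attained: for each fixed [h], the condition on [c] is a closed upper bound. *)
have Eq : E q.
  move=> h domh; have [->|h0] := eqVneq (re_inner h h) 0.
    by rewrite mulr0 re_inner_ge0.
  have h_gt0 : 0 < re_inner h h by rewrite lt0r h0 re_inner_ge0.
  rewrite -ler_pdivlMr //; apply: ge_sup; first by exists (m ^+ 2).
  by move=> c /(_ h domh); rewrite ler_pdivlMr.
pose b := Num.sqrt q.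
have b0 : 0 < b by rewrite sqrtr_gt0.
have bb : b ^+ 2 = q by rewrite sqr_sqrtr ?ltW.
have bt : b < t by rewrite -ltr_sqr ?nnegrE ?ltW // bb.
have [m1 m10 Hm1] := resolvent_coercive _ _ (res (t - b) ltac:(lra)).
have [m2 m20 Hm2] := resolvent_coercive _ _ (res (t + b) ltac:(lra)).
(* With [h = u + b v] below, |u| <= |h| + b |v| <= (1 + b / m2) |h| and m1 |h| <= |g - q v|, so d
   |u| <= |g - q v|. *)
pose d := m1 * m2 / (m2 + b).
have d0 : 0 < d by rewrite divr_gt0 ?mulr_gt0 ?addr_gt0.
suff /q_ub : E (q + d ^+ 2) by rewrite gerDl leNgt exprn_gt0.
(* Since u = (T + t) v lies in the domain, (T + t)^2 can be applied to [v]; then h = (T + t + b) v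
   and (T + t - b) h = g - q v. *)
move=> u domu; have [v domv uE] := resolvent_surjective _ _ u (res t t0).
pose h := u + b%:C *: v; pose g := T u + t%:C *: u.
have [dombv Tbv] := linear_opZ _ b%:C _ linT domv.
have [domh Th] := linear_opD _ _ _ linT domu dombv.
have hE : T v + (t + b)%:C *: v = h.
  by rewrite /h -uE rmorphD scalerDl addrA.
have ghE : T h + (t - b)%:C *: h = g + (- q)%:C *: v.
  have Tht : T h + t%:C *: h = g + b%:C *: (T v + t%:C *: v).
    by rewrite Th Tbv !scalerDr !scalerA (mulrC b%:C) addrACA.
  rewrite rmorphB scalerBl addrA Tht uE /h scalerDr addrKA scalerA.
  by rewrite -rmorphM -expr2 bb rmorphN scaleNr.
have uh : d * re_norm u <= re_norm (g + (- q)%:C *: v).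
  rewrite -ghE; apply: le_trans (Hm1 _ domh).
  have := Hm2 _ domv; rewrite hE => m2v.
  have : re_norm u <= re_norm h + b * re_norm v.
    have -> : u = h + (- b)%:C *: v by rewrite /h rmorphN scaleNr addrK.
    by rewrite (le_trans (re_normD _ _)) // re_normZ normrN gtr0_norm.
  move=> u_le; rewrite /d mulrAC ler_pdivrMr ?addr_gt0 // -!mulrA ler_pM2l //.
  nra.
have gv : re_inner g v = re_inner u u.
  transitivity (re_inner u (T v + t%:C *: v)); last by rewrite uE.
  rewrite /g re_innerDl re_innerDr re_innerZl re_innerZr.
  by rewrite /re_inner symT.
(* Here q |v|^2 <= |u|^2, so |g - q v|^2 = |g|^2 - 2 q |u|^2 + q^2 |v|^2 is at most |g|^2 - q
   |u|^2. *)
have qv := Eq v domv; rewrite uE in qv.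
have : (d * re_norm u) ^+ 2 <= re_norm (g + (- q)%:C *: v) ^+ 2.
  by rewrite ler_sqr ?nnegrE ?(mulr_ge0 (ltW d0)) ?re_norm_ge0.
rewrite exprMn -!re_innerE re_inner_sqrDZ gv -/g.
nra.
Qed.

Lemma symmetric_op_nonneg T f :
  linear_operator T -> symmetric_operator T ->
  (forall s, 0 < s -> resolvent_set T (- s)%:C) ->
  dom T f -> 0 <= re_inner (T f) f.
Proof.
move=> linT symT res domf; rewrite leNgt; apply/negP => Tf_lt0.
have lb t : 0 < t -> 0 <= re_inner (T f) (T f) + 2 * t * re_inner (T f) f.
  move=> t0; have := symmetric_norm_lower_bound T t f linT symT res t0 domf.
  rewrite re_inner_sqrDZ; lra.
(* Large enough to turn the right-hand side of [lb] into -|T f|^2 - 2. *)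
pose t := (re_inner (T f) (T f) + 1) / - re_inner (T f) f.
have tE : t * re_inner (T f) f = - (re_inner (T f) (T f) + 1).
  by rewrite /t; field; rewrite lt_eqF.
have t0 : 0 < t by rewrite divr_gt0 ?oppr_gt0 // ltr_wpDl ?re_inner_ge0.
have := lb t t0; rewrite -mulrA tE.
have := re_inner_ge0 (T f); lra.
Qed.

(** Any vector that [xget] selects in [op_adj] satisfies the adjoint identity, and [T g] is that
    vector. *)
Lemma self_adjoint_symmetric T : self_adjoint T -> symmetric_operator T.
Proof.
move=> [_ [[dom_adj app_adj] _]] f g domf domg.
rewrite -(app_adj g domg) /=; have [h adj_h] := dom_adj g domg.
by case: xgetP => [k _ /(_ f domf)|/(_ h)/(_ adj_h)].
Qed.

Lemma nonnegative_re_inner T f :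
  nonnegative T -> dom T f -> 0 <= re_inner (T f) f.
Proof. by move=> T0 /T0; rewrite mul0r lecE => /andP[_]. Qed.

(** By nonnegativity of the form at f + s g for all real s, [T f] is orthogonal (in real part) to
    [dom T], which is dense. *)
Lemma form_kernel T f :
  linear_operator T -> symmetric_operator T -> densely_defined T ->
  nonnegative T ->
  dom T f -> re_inner (T f) f = 0 -> T f = 0.
Proof.
move=> linT symT denseT T0 domf Tff; apply/eqP/negPn/negP => Tf0.
have orth g : dom T g -> re_inner (T f) g = 0.
  move=> domg.
  have form_ge0 s : 0 <= 2 * s * re_inner (T f) g + s ^+ 2 * re_inner (T g) g.
    have [domsg Tsg] := linear_opZ _ s%:C _ linT domg.
    have [domfsg Tfsg] := linear_opD _ _ _ linT domf domsg.
    have := nonnegative_re_inner _ _ T0 domfsg.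
    rewrite Tfsg Tsg !(re_innerDl, re_innerDr, re_innerZl, re_innerZr) Tff.
    have -> : re_inner (T g) f = re_inner (T f) g.
      by rewrite re_innerC /re_inner symT.
    lra.
  pose c := re_inner (T g) g.
  have c0 : 0 <= c by exact: nonnegative_re_inner.
  (* Nearly the minimizer -r / c; the shift by 1 covers [c = 0]. *)
  have := form_ge0 (- re_inner (T f) g / (c + 1)); rewrite -/c.
  set r := re_inner (T f) g => ge0; apply/eqP.
  rewrite -sqrf_eq0 eq_le sqr_ge0 andbT.
  have k0 : 0 < (c + 2) / (c + 1) ^+ 2 by rewrite divr_gt0 ?exprn_gt0; lra.
  rewrite -(pmulr_rle0 _ k0).
  have -> : (c + 2) / (c + 1) ^+ 2 * r ^+ 2 =
      - (2 * (- r / (c + 1)) * r + (- r / (c + 1)) ^+ 2 * c) by field; lra.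
  by rewrite oppr_le0.
(* By orthogonality |T f - g|^2 = |T f|^2 + |g|^2, so no [g] of the domain is closer to [T f] than
   |T f|. *)
have [g [/= ball_g domg]] : ball (T f) `|T f| `&` dom T !=set0.
  have Tf_gt0 : 0 < `|T f| by rewrite normr_gt0.
  by apply: denseT; [exists (T f); exact: ballxx|exact: ball_open].
move: ball_g; rewrite -ball_normE /ball_ /= !norm_re_norm ltcR ltNge => /negP; apply.
rewrite -ler_sqr ?nnegrE ?re_norm_ge0 // -!re_innerE.
have -> : T f - g = T f + (- 1)%:C *: g by rewrite rmorphN scaleN1r.
rewrite re_inner_sqrDZ (orth g) //.
have := re_inner_ge0 g; lra.
Qed.

End operators.

Theorem theorem2p2 (R : realType) (H : hilbertType R)
  (H_separable : separable_space H)
  (S A V : operator H) (kappa : R)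
  (S_linear : linear_operator S)
  (S_dense : densely_defined S)
  (S_closed : closed_operator S)
  (S_symmetric : symmetric_operator S)
  (kappa_ge0 : 0 <= kappa)
  (S_bounded_below : bounded_below S kappa)
  (A_linear : linear_operator A)
  (A_self_adjoint : self_adjoint A)
  (A_nonnegative : nonnegative A)
  (A_extends_S : op_extends S A)
  (A_ker : op_ker A <> [set 0])
  (V_linear : linear_operator V)
  (V_self_adjoint : self_adjoint V)
  (V_nonnegative : nonnegative V)
  (V_relatively_compact : relatively_compact V A)
  (A_ker_V_ker : ~ (op_ker A `<=` op_ker V))
  (alpha : R) (alpha_lt0 : alpha < 0) :
  (spectrum (op_add A (op_scale alpha%:C V)) `&`
     real_complex R @` `]-oo, 0[) !=set0.
Proof.
have [f kerf kerVf] : exists2 f, op_ker A f & ~ op_ker V f.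
  by move/existsNP: A_ker_V_ker => [f /not_implyP[? ?]]; exists f.
have [domVA _] := V_relatively_compact; have [domf Af] := kerf.
have symA := self_adjoint_symmetric A A_self_adjoint.
have symV := self_adjoint_symmetric V V_self_adjoint.
have Vff : 0 < re_inner (V f) f.
  rewrite lt0r nonnegative_re_inner // ?andbT; last exact: domVA.
  apply/eqP => Vff0; apply: kerVf; split; first exact: domVA.
  by apply: form_kernel => //; [case: V_self_adjoint|exact: domVA].
pose T := op_add A (op_scale alpha%:C V).
have linT : linear_operator T.
  have [A0 linA] := A_linear; have [V0 linV] := V_linear.
  split=> // a g h [domAg domVg] [domAh domVh].
  have [domA AE] := linA a g h domAg domAh; have [domV VE] := linV a g h domVg domVh.
  split => //=.
  by rewrite AE VE !scalerDr !scalerA (mulrC a) addrACA.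
have symT : symmetric_operator T.
  move=> g h [domAg domVg] [domAh domVh] /=.
  rewrite linearDl linearDr linearZl_LR linearZr_LR; congr (_ + _); first exact: symA.
  (* The scalar leaves the second argument conjugated, and [alpha] is real. *)
  congr (_ * _); [exact/esym/conjc_real|exact: symV].
apply/not_existsP => noneg.
have res s : 0 < s -> resolvent_set T (- s)%:C.
  move=> s0; apply: contrapT => spec; apply: (noneg (- s)%:C); split => //.
  by exists (- s) => //=; rewrite in_itv /= oppr_lt0.
have := symmetric_op_nonneg T f linT symT res (conj domf (domVA _ domf)).
by rewrite /= Af add0r re_innerZl pmulr_lge0 // leNgt alpha_lt0.
Qed.
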